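(* Let $(X,r)$ be an indecomposable solution such that $\mathcal{G}(X,r)$ is a minimal non-cyclic group. Then $(X,r)$ is uniconnected.
   Context: A solution is a pair $(X,r)$ with $X$ a non-empty set and $r:X\times X\to X\times X$, $r(x,y)=(\sigma_x(y),\tau_y(x))$, such that $(r\times \mathrm{id})(\mathrm{id}\times r)(r\times \mathrm{id})=(\mathrm{id}\times r)(r\times \mathrm{id})(\mathrm{id}\times r)$ on $X^3$, $r^2=\mathrm{id}$ (involutive), and all maps $\sigma_x,\tau_y:X\to X$ are bijections (non-degenerate). The permutation group $\mathcal{G}(X,r)$ is the subgroup of $\mathrm{Sym}(X)$ generated by all $\sigma_x$. $(X,r)$ is indecomposable if $\mathcal{G}(X,r)$ acts transitively on $X$, and uniconnected if $\mathcal{G}(X,r)$ acts regularly on $X$. A finite group is minimal non-cyclic if it is not cyclic and every proper subgroup of it is cyclic. *)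

(* Defs.v *)
From HB Require Import structures.
From mathcomp Require Import all_boot.
From mathcomp Require Import boolp classical_sets functions cardinality.

Set Implicit Arguments.
Unset Strict Implicit.
Unset Printing Implicit Defensive.

Local Open Scope classical_set_scope.
Local Open Scope group_scope.

(* [X] is an arbitrary type, so [{perm X}] is not available; the composition
   convention is (f * g)(x) = f (g x). *)
Record sym (X : Type) := Sym { sym_fun :> X -> X; sym_bij : bijective sym_fun }.

Section SymGroup.
Variable X : Type.
Implicit Types f g : sym X.

HB.instance Definition _ := gen_eqMixin (sym X).
HB.instance Definition _ := gen_choiceMixin (sym X).

Lemma symP f g : f =1 g -> f = g.
Proof.
case: f g => [f bf] [g bg] /= /funext fg.
by case: _ / fg in bg *; congr Sym; exact: Prop_irrelevance.
Qed.

Definition sym_one : sym X := Sym (@inv_bij X id (fun=> erefl)).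

Definition sym_mul f g : sym X := Sym (bij_comp (sym_bij f) (sym_bij g)).

Lemma sym_inv_ex f : exists h : sym X, cancel f h /\ cancel h f.
Proof.
have [h fK hK] := sym_bij f.
by exists (Sym (Bijective hK fK)).
Qed.

Definition sym_inv f : sym X := sval (cid (sym_inv_ex f)).

Lemma sym_invK f : cancel f (sym_inv f).
Proof. exact: (svalP (cid (sym_inv_ex f))).1. Qed.

Lemma sym_invKV f : cancel (sym_inv f) f.
Proof. exact: (svalP (cid (sym_inv_ex f))).2. Qed.

Fact sym_mulA : associative sym_mul.
Proof. by move=> f g h; exact: symP. Qed.

Fact sym_mul1 : left_id sym_one sym_mul.
Proof. by move=> f; exact: symP. Qed.

Fact sym_mulr1 : right_id sym_one sym_mul.
Proof. by move=> f; exact: symP. Qed.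

Fact sym_mulV : left_inverse sym_one sym_inv sym_mul.
Proof. by move=> f; apply: symP => x; exact: sym_invK. Qed.

Fact sym_mulrV : right_inverse sym_one sym_inv sym_mul.
Proof. by move=> f; apply: symP => x; exact: sym_invKV. Qed.

HB.instance Definition _ := isGroup.Build (sym X)
  sym_mulA sym_mul1 sym_mulr1 sym_mulV sym_mulrV.

End SymGroup.

Section Subgroups.
Variable G : groupType.
Implicit Types A H K : set G.

Definition is_subgroup H :=
  [/\ H 1, forall x y, H x -> H y -> H (x * y) & forall x, H x -> H x^-1].

Definition subgroup_gen A : set G := smallest is_subgroup A.

Lemma subgroup_gen_subgroup A : is_subgroup (subgroup_gen A).
Proof.
split=> [H [[]] //|x y Ax Ay H HA|x Ax H HA]; have [[_ HM HV] _] := HA.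
- by apply: HM; [apply: Ax | apply: Ay].
- by apply: HV; apply: Ax.
Qed.

Definition is_cyclic H := exists g, H = subgroup_gen [set g].

Definition minimal_noncyclic H :=
  [/\ is_subgroup H, finite_set H, ~ is_cyclic H &
      forall K, is_subgroup K -> K `<` H -> is_cyclic K].

End Subgroups.

Section Actions.
Variable X : Type.
Implicit Types H : set (sym X).

Definition acts_transitively H := forall x y : X, exists2 g, H g & g x = y.

Definition acts_regularly H :=
  acts_transitively H /\ forall g (x : X), H g -> g x = x -> g = 1.

End Actions.

Section Solutions.
Variable X : Type.

Definition r_id (r : X * X -> X * X) (t : X * X * X) : X * X * X :=
  (r t.1, t.2).

Definition id_r (r : X * X -> X * X) (t : X * X * X) : X * X * X :=
  let yz := r (t.1.2, t.2) in (t.1.1, yz.1, yz.2).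

Record solution := Solution {
  sol_r :> X * X -> X * X;
  sol_nonempty : [set: X] !=set0;
  sol_braid : r_id sol_r \o id_r sol_r \o r_id sol_r =1
              id_r sol_r \o r_id sol_r \o id_r sol_r;
  sol_involutive : involutive sol_r;
  sol_sigma_bij : forall x, bijective (fun y => (sol_r (x, y)).1);
  sol_tau_bij : forall y, bijective (fun x => (sol_r (x, y)).2) }.

Definition sigma (r : solution) (x : X) : sym X := Sym (sol_sigma_bij r x).

Definition permutation_group (r : solution) : set (sym X) :=
  subgroup_gen (range (sigma r)).

Definition indecomposable (r : solution) :=
  acts_transitively (permutation_group r).

Definition uniconnected (r : solution) :=
  acts_regularly (permutation_group r).

End Solutions.

(* Main.v *)
Require Import Defs.
From mathcomp Require Import boolp classical_sets functions cardinality.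
From mathcomp Require Import all_boot all_fingroup all_solvable.
From mathcomp Require Import zify.

(** Let G be the permutation group and suppose that some point stabiliser C is
    non-trivial; C contains no non-trivial normal subgroup of G, because G is
    transitive and faithful. In particular G is not abelian.

    Group theory first reduces to prime degree. A non-abelian group whose
    maximal subgroups are abelian has a normal maximal subgroup N
    ([normal_maximal_exists]). A subgroup K of prime order q of C is not normal
    in G, whereas every subgroup of the cyclic normal group N is; so K is not in
    N, and G is the semidirect product of N by K. Every proper subgroup S of N
    generates with K a proper, hence abelian, subgroup; together with the
    theory of coprime action this forces N to have prime order p
    ([corefree_prime_index]). So the degree is p, the order of G is pq, and
    q < p since G embeds in the symmetric group of degree p
    ([nonregular_prime_degree]).

    The solution enters through the law of its cycle set, x . y being
    the preimage of y under sigma_x. It provides an abelian group of the same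
    order as G on which G acts by automorphisms, together with an equivariant
    map t from X to it ([translationJ]), and t x determines sigma_x. This is the
    additive group of the permutation brace, here realised as a regular group of
    permutations of the set G. As its order is pq, the p-part and the p'-part of
    t x lie in groups of order p and q. An equivariant map
    from a transitive G-set of size p to a group with at most p elements, on
    which G acts by automorphisms, is constant
    ([equivariant_small_constant]): were it injective, it would take p values,
    none of them the identity. So t is constant, all sigma_x coincide and
    G is cyclic, a contradiction. *)

Set Implicit Arguments.
Unset Strict Implicit.
Unset Printing Implicit Defensive.

Local Open Scope group_scope.

(** * Groups whose maximal subgroups are abelian *)

Section MinimalNonabelian.

Variables (gT : finGroupType) (G : {group gT}).
Hypothesis nonabelG : ~~ abelian G.
Hypothesis abel_max : forall M : {group gT}, maximal M G -> abelian M.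

Let maximal_sub (M : {group gT}) : maximal M G -> M \subset G.
Proof. by move/maxgroupp/proper_sub. Qed.

Lemma maximal_cover x : x \in G ->
  exists2 M : {group gT}, maximal M G & x \in M.
Proof.
move=> Gx; have sxG : <[x]> \subset G by rewrite cycle_subG.
case: (maximal_exists sxG) => [defG | [M maxM]].
  by case/negP: nonabelG; rewrite -defG cycle_abelian.
by rewrite cycle_subG; exists M.
Qed.

Lemma center_sub_maximal (M : {group gT}) : maximal M G -> 'Z(G) \subset M.
Proof.
move=> maxM; have [/proper_sub sMG maxMG] := maxgroupP maxM.
have cMZ : 'Z(G) \subset 'C(M) by rewrite (subset_trans (subsetIr _ _)) ?centS.
have [pr | ] := boolP (M <*> 'Z(G) \proper G).
  by rewrite -(maxMG _ pr) ?joing_subr ?joing_subl.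
rewrite properE join_subG sMG center_sub /= negbK => sG.
case/negP: nonabelG; apply: abelianS sG _.
by rewrite abelianY abel_max // center_abelian.
Qed.

Lemma maximal_cent1 (M : {group gT}) x :
  maximal M G -> x \in M -> x \notin 'Z(G) -> 'C_G[x] = M.
Proof.
move=> maxM Mx nZx; have [/proper_sub sMG maxMG] := maxgroupP maxM.
have Gx := subsetP sMG x Mx.
apply: (maxMG 'C_G[x]%G).
  rewrite properE subcent1_sub; apply: contra nZx => /subsetP sG.
  apply/centerP; split=> // y Gy.
  by have /subcent1P[_ ] := sG y Gy.
rewrite subsetI sMG /=; apply: subset_trans (abel_max maxM) _.
by rewrite -cent_set1 centS // sub1set.
Qed.

(** By [maximal_cent1] a non-central element lies in at most one maximal
    subgroup, so the conjugates of M, whose number is the index of M, are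
    pairwise disjoint outside the centre. *)
Lemma card_support_maximal (M : {group gT}) :
  maximal M G -> ~~ (M <| G) ->
  #|class_support (M :\: 'Z(G)) G| + #|'Z(G)| * #|G : M| = #|G|.
Proof.
move=> maxM nnM; have [/proper_sub sMG maxMG] := maxgroupP maxM.
have sZM := center_sub_maximal maxM.
have prZ : 'Z(G) \proper M.
  rewrite properEneq sZM andbT; apply: contra nnM => /eqP <-.
  exact: center_normal.
have nZG g : g \in G -> g \in 'N('Z(G)).
  by move=> Gg; apply: (subsetP (normal_norm (center_normal G))).
have nM : 'N_G(M) = M.
  apply: (maxMG 'N_G(M)%G); last by rewrite subsetI sMG normG.
  rewrite properE subsetIl; apply: contra nnM.
  by rewrite subsetI subxx /normal sMG.
have TI : normedTI (M :\: 'Z(G)) G M.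
  apply/normedTI_P; split.
  - by rewrite setD_eq0; case/andP: prZ.
  - rewrite subsetI sMG normsD ?normG //.
    exact: subset_trans sMG (normal_norm (center_normal G)).
  - move=> g Gg /pred0Pn[x /= /andP[/setDP[Mx nZx]]].
    rewrite conjDg => /setDP[Mgx _].
    have maxMg : maximal (M :^ g) G by rewrite -(conjGid Gg) maximalJ.
    rewrite -nM inE Gg; apply/normP.
    have cMg : 'C_G[x] = M :^ g by apply: (@maximal_cent1 (M :^ g)%G).
    by rewrite -cMg (maximal_cent1 maxM).
rewrite (card_support_normedTI TI) cardsD (setIidPr sZM).
by rewrite -mulnDl subnK ?Lagrange ?subset_leq_card.
Qed.

Lemma half_support_maximal (M : {group gT}) :
  maximal M G -> ~~ (M <| G) ->
  #|G| <= 2 * #|class_support (M :\: 'Z(G)) G|.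
Proof.
move=> maxM nnM; have cardG := card_support_maximal maxM nnM.
have sMG := maximal_sub maxM; have sZM := center_sub_maximal maxM.
have prZ : 'Z(G) \proper M.
  rewrite properEneq sZM andbT; apply: contra nnM => /eqP <-.
  exact: center_normal.
have Z2 : 2 * (#|'Z(G)| * #|G : M|) <= #|G|.
  rewrite mulnA -(Lagrange sMG) leq_mul2r -(Lagrange sZM) mulnC.
  by rewrite leq_mul2l indexg_gt1 (proper_subn prZ) !orbT.
by lia.
Qed.

(** If no maximal subgroup were normal, then the conjugates of a single M would
    miss a non-central y, and those of a maximal N containing y would be
    disjoint from them outside the centre; but the non-central parts of either
    class cover at least half of G. *)
Lemma normal_maximal_exists :
  exists2 M : {group gT}, maximal M G & M <| G.
Proof.
have [M maxM _] := maximal_cover (group1 G).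
have [nM | nnM] := boolP (M <| G); first by exists M.
pose cs (L : {group gT}) := class_support (L :\: 'Z(G)) G.
have nZG g : g \in G -> g \in 'N('Z(G)).
  by apply: (subsetP (normal_norm (center_normal G))).
have csZ (L : {group gT}) : maximal L G -> cs L \subset G :\: 'Z(G).
  move=> maxL; apply/subsetP=> _ /imset2P[x g /setDP[Lx nZx] Gg ->].
  apply/setDP; split; last by rewrite memJ_norm ?nZG.
  by rewrite groupJr // (subsetP (maximal_sub maxL)).
have cardGZ : #|G :\: 'Z(G)| + #|'Z(G)| = #|G|.
  rewrite cardsD (setIidPr (center_sub G)).
  by rewrite subnK ?subset_leq_card ?center_sub.
have Z_gt0 : 0 < #|'Z(G)| := cardG_gt0 _.
(* The conjugates of M cover |G| - |Z(G)||G : M| < |G| - |Z(G)| elements. *)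
have [y /setDP[Gy nZy] ncs] : exists2 y, y \in G :\: 'Z(G) & y \notin cs M.
  apply/subsetPn/negP=> /subset_leq_card sG.
  have ltZ : #|'Z(G)| < #|'Z(G)| * #|G : M|.
    by rewrite ltn_Pmulr // indexg_gt1 proper_subn ?(maxgroupp maxM).
  have arith (a b c d e : nat) :
    a + b = c -> d + e = c -> a <= d -> b < e -> False by lia.
  exact: arith cardGZ (card_support_maximal maxM nnM) sG ltZ.
have [N maxN Ny] := maximal_cover Gy.
exists N => //; apply: contraR ncs => nnN.
have : ~~ [disjoint cs M & cs N].
  rewrite -leq_card_setU; apply/eqP=> cardU.
  have := subset_leq_card (_ : cs M :|: cs N \subset G :\: 'Z(G)).
  rewrite subUset !csZ // cardU => /(_ isT).
  have arith (a b c d e : nat) :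
    a + b = c -> 0 < b -> c <= 2 * d -> c <= 2 * e -> d + e <= a -> False.
    by lia.
  exact: arith cardGZ Z_gt0 (half_support_maximal maxM nnM)
               (half_support_maximal maxN nnN).
case/pred0Pn=> w /= /andP[/imset2P[a g /setDP[Ma nZa] Gg defw]].
case/imset2P=> b h /setDP[Nb nZb] Gh wE.
have nZw : w \notin 'Z(G) by rewrite defw memJ_norm ?nZG.
have maxJ (L : {group gT}) k : k \in G -> maximal L G -> maximal (L :^ k) G.
  by move=> Gk maxL; rewrite -(conjGid Gk) maximalJ.
have eqMN : M :^ g = N :^ h.
  have <- : 'C_G[w] = M :^ g.
    by apply: (@maximal_cent1 (M :^ g)%G); rewrite ?maxJ // defw memJ_conjg.
  by apply: (@maximal_cent1 (N :^ h)%G); rewrite ?maxJ // wE memJ_conjg.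
have My : y ^ (h * g^-1) \in M.
  by rewrite conjgM -mem_conjg eqMN memJ_conjg.
apply/imset2P; exists (y ^ (h * g^-1)) (h * g^-1)^-1; last 1 first.
- by rewrite conjgK.
- by apply/setDP; split=> //; rewrite memJ_norm // nZG // groupM ?groupV.
- by rewrite groupV groupM ?groupV.
Qed.

End MinimalNonabelian.

(** * Non-regular faithful actions have prime degree *)

Lemma prime_dvd_fact q n : prime q -> (q %| n`!) = (q <= n).
Proof.
move=> prq; apply/idP/idP=> [|leqn]; last by rewrite dvdn_fact ?prime_gt0.
elim: n => [|n IHn]; first by rewrite Euclid_dvd1.
rewrite factS Euclid_dvdM // => /orP[/dvdn_leq-> // | /IHn leqn].
exact: leqW.
Qed.

(** The hypothesis on K holds for every subgroup of prime order of a point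
    stabiliser of a faithful transitive action. Such a K acts non-trivially on a
    cyclic normal maximal subgroup N, but trivially on every proper subgroup of
    N. As K and N have coprime orders, this gives N = [N, K], where only the
    identity is centralised by K; so N has no proper non-trivial subgroup. *)
Lemma corefree_prime_index (gT : finGroupType) (G K : {group gT}) :
    ~~ abelian G -> (forall H : {group gT}, H \proper G -> cyclic H) ->
    K \subset G -> prime #|K| -> ~~ (K <| G) ->
  exists2 p, prime p & #|G| = (p * #|K|)%N.
Proof.
move=> nonabelG cycP sKG prK nnK.
have abelP (H : {group gT}) : H \proper G -> abelian H.
  by move/cycP/cyclic_abelian.
have [||N maxN nNG] := @normal_maximal_exists gT G => //.
  by move=> M /maxgroupp/abelP.
have [prN maxNG] := maxgroupP maxN; have [sNG _] := andP prN.
have nNK : K \subset 'N(N) := subset_trans sKG (normal_norm nNG).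
have cycN := cycP N prN; have abelN := cyclic_abelian cycN.
have nSG (S : {group gT}) : S \subset N -> S <| G.
  by move=> sSN; apply: char_normal_trans nNG; rewrite sub_cyclic_char.
have nsKN : ~~ (K \subset N) by apply: contra nnK; apply: nSG.
have tiKN : K :&: N = 1 by apply: prime_TIg.
have defG : N <*> K = G.
  apply/eqP; rewrite eqEsubset join_subG sNG sKG /=.
  apply: contraR nsKN => nsG.
  rewrite -(maxNG (N <*> K)%G) ?joing_subl ?joing_subr //.
  by rewrite properE join_subG sNG sKG.
have cardG : #|G| = (#|N| * #|K|)%N.
  by rewrite -defG norm_joinEr // TI_cardMg // setIC.
have tiSK (S : {group gT}) : S \subset N -> S :&: K = 1.
  by move=> sSN; apply/trivgP; rewrite -tiKN (setIC K) setSI.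
have centS (S : {group gT}) : S \subset N -> S :!=: N -> S \subset 'C(K).
  move=> sSN neqSN.
  have nSK : K \subset 'N(S) := subset_trans sKG (normal_norm (nSG S sSN)).
  have prSK : S <*> K \proper G.
    rewrite properEcard join_subG (subset_trans sSN) //= sKG.
    rewrite norm_joinEr // TI_cardMg ?tiSK //.
    by rewrite cardG ltn_pmul2r ?cardG_gt0 // proper_card // properEneq neqSN.
  by rewrite centsC (sub_abelian_cent2 (abelP _ prSK)) ?joing_subl ?joing_subr.
have ncNK : ~~ (N \subset 'C(K)).
  apply: contra nonabelG => cNK.
  by rewrite -defG abelianY abelN cyclic_abelian ?prime_cyclic // centsC.
have ntN : N :!=: 1 by apply: contraNneq ncNK => ->; rewrite sub1G.
have prN1 : 1 < #|N| by rewrite cardG_gt1.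
pose s := pdiv #|N|; have prs : prime s := pdiv_prime prN1.
have [z Nz oz] := Cauchy prs (pdiv_dvd #|N|).
have sZN : <[z]> \subset N by rewrite cycle_subG.
have [defN | neqN] := eqVneq <[z]> N.
  by exists s => //; rewrite cardG -oz orderE defN.
have cZK := centS _ sZN neqN.
(* If q divided |N|, then N and K would contain two distinct subgroups of order
   q, which together generate a non-cyclic abelian group, hence all of G. *)
have coNK : coprime #|N| #|K|.
  rewrite coprime_sym prime_coprime //; apply/negP=> dvKN.
  have [t Nt ot] := Cauchy prK dvKN.
  have sTN : <[t]> \subset N by rewrite cycle_subG.
  have nTK : K \subset 'N(<[t]>) := subset_trans sKG (normal_norm (nSG _ sTN)).
  have tiTK := tiSK _ sTN.
  have cardTK : #|<[t]> <*> K| = (#|K| ^ 2)%N.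
    by rewrite norm_joinEr // TI_cardMg // -orderE ot.
  have abTK : abelian (<[t]> <*> K) by apply: card_p2group_abelian prK _.
  have [prTK | ] := boolP (<[t]> <*> K \proper G).
    have cTK : K \subset 'C(<[t]>).
      by rewrite (sub_abelian_cent2 abTK) ?joing_subl ?joing_subr.
    have := cyclic_dprod (dprodEY cTK tiTK).
    rewrite cycle_cyclic prime_cyclic // cycP // -orderE ot => /(_ isT isT).
    by rewrite /coprime gcdnn => /esym/eqP oK1; rewrite oK1 in prK.
  rewrite properE join_subG (subset_trans sTN) // sKG /= negbK => sG.
  by case/negP: nonabelG; apply: abelianS abTK.
(* No non-trivial element of [N, K] is centralised by K; were [N, K] proper in
   N, it would be centralised by K, hence trivial. *)
have defR : [~: N, K] = N.
  apply/eqP; apply: contraR ncNK => neqR.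
  have sRN : [~: N, K] \subset N by rewrite commg_subl.
  have := coprime_abel_cent_TI nNK coNK abelN.
  by rewrite (setIidPl (centS _ sRN neqR)) => /commG1P.
have := coprime_abel_cent_TI nNK coNK abelN.
rewrite defR => CN1.
have : z \in 'C_N(K) by rewrite inE Nz (subsetP cZK) ?cycle_id.
by rewrite CN1 => /set1P=> z1; move: oz prs; rewrite z1 order1 => <-.
Qed.

Lemma nonregular_prime_degree (T : finType) (G : {group {perm T}}) (x : T) :
    [transitive G, on [set: T] | 'P] ->
    ~~ cyclic G -> (forall H : {group {perm T}}, H \proper G -> cyclic H) ->
    'C_G[x | 'P] != 1 ->
  [/\ prime #|T|, #|T| %| #|G| & #|G| %/ #|T| < #|T|].
Proof.
move=> trG ncG cycP ntC; set C := 'C_G[x | 'P] in ntC.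
have core1 (K : {group {perm T}}) : K <| G -> K \subset C -> K :=: 1.
  case/andP=> sKG nKG sKC; apply/trivgP/subsetP=> k Kk.
  apply/set1P/permP=> y; rewrite perm1.
  have [g Gg ->] := atransP2 trG (in_setT x) (in_setT y).
  have : k ^ g^-1 \in K by rewrite memJ_norm // groupV (subsetP nKG).
  move/(subsetP sKC)/setIP=> [_ /astab1P].
  rewrite /= /aperm conjgE invgK !permM => /(congr1 g).
  by rewrite permKV.
have sCG : C \subset G := subsetIl _ _.
have nonabelG : ~~ abelian G.
  apply: contra ntC => abelG; apply/eqP; apply: (core1 [group of C]) => //.
  rewrite /normal sCG; apply: cents_norm.
  exact: subset_trans abelG (centS _).
have C1 : 1 < #|C| by rewrite cardG_gt1.
have prq := pdiv_prime C1; set q := pdiv _ in prq.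
have [k Ck ok] := Cauchy prq (pdiv_dvd #|C|).
have sKC : <[k]> \subset C by rewrite cycle_subG.
have cardK : #|<[k]>| = q by rewrite -orderE ok.
have prK : prime #|<[k]>| by rewrite cardK.
have [||p prp cardG] := corefree_prime_index nonabelG cycP _ prK.
- exact: subset_trans sKC sCG.
- apply/negP=> nK; have K1 := core1 _ nK sKC.
  by move: prK; rewrite K1 cards1.
have cardTC : (#|T| * #|C|)%N = #|G|.
  by rewrite -(card_orbit_stab 'P G x) (atransP trG) ?inE // cardsT.
(* |T|! rules out |T| = 1, and later bounds q, as pq divides p!. *)
have dvGT : #|G| %| (#|T|)`!.
  by rewrite -card_Sym cardSg ?subsetT.
have cardT : #|T| = p.
  have T1 : #|T| != 1%N.
    apply: contraNneq ncG => T1.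
    by move: dvGT; rewrite T1 dvdn1 => /eqP/card1_trivg ->; apply: cyclic1.
  have: #|T| %| p.
    have /dvdnP[m cardC] := cardSg sKC.
    move: cardTC; rewrite cardG cardC cardK mulnA => /eqP.
    rewrite eqn_pmul2r ?prime_gt0 // => /eqP <-; exact: dvdn_mulr.
  by move=> /(prime_nt_dvdP prp T1).
rewrite cardT cardG cardK dvdn_mulr // mulKn ?prime_gt0 //; split=> //.
move: dvGT; rewrite cardT cardG cardK -{2}(prednK (prime_gt0 prp)) factS.
rewrite prednK ?prime_gt0 // dvdn_pmul2l ?prime_gt0 // => dvqf.
by rewrite -[p]prednK ?prime_gt0 // ltnS -prime_dvd_fact.
Qed.

(** * Equivariant maps on a set of prime size *)

(** The fibres of f have the same size, a divisor of the prime |T|. If f is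
    injective, its image fills B; but if f takes the value 1 at one point, then
    it does so at all points, because conjugation fixes 1. *)
Lemma equivariant_small_constant (T : finType) (gT : finGroupType)
    (G : {group {perm T}}) (B : {group gT}) (f : T -> gT) (c : {perm T} -> gT) :
    [transitive G, on [set: T] | 'P] -> prime #|T| ->
    (forall x, f x \in B) -> #|B| <= #|T| ->
    (forall h x, h \in G -> f (h x) = f x ^ c h) ->
  forall x y, f x = f y.
Proof.
move=> trG prT Bf leBT fJ x y.
have trP u v : exists2 h : {perm T}, h \in G & v = h u.
  exact: (atransP2 trG (in_setT u) (in_setT v)).
pose D z := [set w in [set: T] | f z == f w].
have cardD z : #|D z| = #|D x|.
  have [h Gh ->] := trP x z; rewrite -(card_imset (D x) (@perm_inj _ h)).
  apply: eq_card => w; rewrite !inE -{1 2}(permKV h w).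
  rewrite mem_imset; last exact: perm_inj.
  by rewrite !inE !(fJ h) // (inj_eq (conjg_inj _)).
have unifD (C : {set T}) :
    C \in preim_partition f [set: T] -> #|C| = #|D x|.
  by move=> /imsetP[z _ ->]; apply: cardD.
have := card_uniform_partition unifD (preim_partitionP f [set: T]).
rewrite cardsT => cardT.
have: #|D x| %| #|T| by rewrite cardT dvdn_mull.
have [D1 _ | nD1 /(prime_nt_dvdP prT nD1) DT] := eqVneq #|D x| 1%N; last first.
  have: D x == [set: T] by rewrite eqEcard subsetT cardsT DT /=.
  by move/eqP/setP/(_ y); rewrite !inE => /eqP.
have inj_f : injective f.
  move=> u v fuv; have /cards1P[w Dw] : #|D u| == 1%N by rewrite cardD D1.
  have : u \in D u by rewrite !inE eqxx.
  have : v \in D u by rewrite !inE fuv eqxx.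
  by rewrite Dw !inE => /eqP-> /eqP->.
have [/existsP[z /eqP fz1] | nf1] := boolP [exists z, f z == 1].
  have f1 u : f u = 1 by have [h Gh ->] := trP z u; rewrite fJ // fz1 conj1g.
  by rewrite !f1.
have : #|f @: [set: T]| <= #|B^#|.
  apply: subset_leq_card; apply/subsetP=> _ /imsetP[u _ ->].
  rewrite !inE Bf andbT; apply: contra nf1 => fu1.
  by apply/existsP; exists u.
rewrite card_imset // cardsT => leT; have := leq_trans leBT leT.
by rewrite (cardsD1 1 B) group1 ltnn.
Qed.

(** * The additive group of a cycle set *)

Section CycleSet.

Variables (T : finType) (s : T -> {perm T}).
Hypothesis cycle_law : forall x y, s x * s (s x y) = s y * s (s y x).
Hypothesis diag_inj : injective (fun x => s x x).

Definition cycle_group := <<[set s x | x : T]>>.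
Canonical cycle_group_group := [group of cycle_group].
Local Notation G := cycle_group.

Lemma mem_cycle_group x : s x \in G.
Proof. by rewrite mem_gen // imset_f. Qed.

(** In the permutation brace this is addition of the generator s x to g: in
    terms of the product, s x + g = g * s (g x). It is made trivial outside G
    so that the permutations it generates act faithfully on G. *)
Definition translate x (g : {perm T}) := if g \in G then g * s (g x) else g.

Lemma translate_mem x g : (translate x g \in G) = (g \in G).
Proof.
rewrite /translate; case: ifP => // Gg.
by rewrite groupM ?Gg ?mem_cycle_group.
Qed.

(** The image k of g under translation by x satisfies k x = s (g x) (g x), so
    injectivity of the diagonal recovers g x, and then g. *)
Lemma translate_inj x : injective (translate x).
Proof.
move=> g h eq_gh; have := congr1 (mem G) eq_gh.
rewrite /= !translate_mem; move: eq_gh; rewrite /translate.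
case: ifP => Gg; case: ifP => Gh // eq_gh _.
have eqx : g x = h x.
  have := congr1 (fun k : {perm T} => k x) eq_gh.
  by rewrite !permM => /diag_inj.
by move: eq_gh; rewrite eqx => /mulIg.
Qed.

Definition translation x : {perm {perm T}} := perm (@translate_inj x).

Definition translation_group := <<[set translation x | x : T]>>.
Canonical translation_group_group := [group of translation_group].
Local Notation A := translation_group.

Lemma mem_translation_group x : translation x \in A.
Proof. by rewrite mem_gen // imset_f. Qed.

Lemma translationE x g : g \in G -> translation x g = g * s (g x).
Proof. by rewrite permE /translate => ->. Qed.

(** The cycle set law is exactly what makes addition commutative. *)
Lemma translation_group_abelian : abelian A.
Proof.
rewrite abelian_gen; apply/centsP=> _ /imsetP[x _ ->] _ /imsetP[y _ ->].
apply/permP=> g; rewrite !permM.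
have [Gg | nGg] := boolP (g \in G); last first.
  by rewrite !permE /translate !(negPf nGg).
rewrite !translationE ?groupM ?mem_cycle_group //.
by rewrite -!mulgA !permM cycle_law.
Qed.

Lemma translation_group_acts : A \subset 'N(G | 'P).
Proof.
rewrite gen_subG; apply/subsetP=> _ /imsetP[x _ ->].
rewrite !inE; apply/subsetP=> g Gg; rewrite inE /= /aperm permE.
by rewrite translate_mem.
Qed.

(** As x varies, the translates of g in G run over all g * s y, and G is
    generated by the s y as a monoid because it is finite. *)
Lemma translation_orbit : orbit 'P A 1 = G.
Proof.
apply/eqP; rewrite eqEsubset acts_sub_orbit ?translation_group_acts // group1.
apply/subsetP=> _ /gen_prodgP[n [c Sc ->]].
elim: n c Sc => [|n IHn] c Sc; first by rewrite big_ord0 orbit_refl.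
rewrite big_ord_recr /=; set g := \prod_(i < n) _.
have Og : g \in orbit 'P A 1 by apply: IHn => i.
have Gg : g \in G by apply: group_prod => i _; apply: mem_gen.
have /imsetP[y _ ->] := Sc ord_max.
have -> : g * s y = 'P%act g (translation (g^-1 y)).
  by rewrite /= /aperm translationE // permKV.
by rewrite (orbit_trans _ Og) // mem_orbit ?mem_translation_group.
Qed.

(** An abelian transitive group is regular. *)
Lemma card_translation_group : #|A| = #|G|.
Proof.
rewrite -(card_orbit_stab 'P A 1) translation_orbit.
suff -> : 'C_A[1 | 'P] = 1 by rewrite cards1 muln1.
apply/trivgP/subsetP=> a /setIP[Aa /astab1P]; rewrite /= /aperm => a1.
apply/set1P/permP=> g; rewrite perm1.
have [|nGg] := boolP (g \in G).
  rewrite -translation_orbit => /imsetP[b Ab ->]; rewrite /= /aperm.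
  by rewrite -permM (centsP translation_group_abelian b) // permM a1.
have fixA : A \subset 'C(~: G | 'P).
  rewrite gen_subG; apply/subsetP=> _ /imsetP[x _ ->].
  rewrite !inE; apply/subsetP=> h; rewrite !inE /= /aperm permE /translate.
  by move/negPf->.
by have /astabP/(_ g) := subsetP fixA a Aa; rewrite inE => /(_ nGg).
Qed.

(** Conjugation by left multiplication by h is the automorphism by which h acts
    on the additive group; the inverse is there because permutations act on the
    right. *)
Lemma translationJ h x :
  h \in G -> translation (h x) = translation x ^ (perm (mulgI h))^-1.
Proof.
move=> Gh; rewrite conjgE invgK mulgA; apply: (canRL (mulgK _)).
apply/permP=> g; rewrite !permM !permE /translate groupMl //.
by case: ifP; rewrite ?permM ?mulgA.
Qed.

(** The additive group has order pm with m < p = |T|, so that both its p-part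
    and its p'-part have at most |T| elements, and
    [equivariant_small_constant] applies to the constituents of translations. *)
Lemma prime_degree_constant :
    [transitive G, on [set: T] | 'P] -> prime #|T| -> #|T| %| #|G| ->
    #|G| %/ #|T| < #|T| ->
  forall x y, s x = s y.
Proof.
move=> trG prT /dvdnP[m cardG] ltm x y.
have m_gt0 : 0 < m by case: (m) cardG (cardG_gt0 [group of G]) => // ->.
rewrite cardG mulnK ?prime_gt0 // in ltm.
suff eqt: translation x = translation y.
  have := congr1 (fun k : {perm {perm T}} => k 1) eqt.
  by rewrite !translationE ?group1 // !mul1g !perm1.
have pi_const (pi : nat_pred) : (#|A|)`_pi <= #|T| ->
    (translation x).`_pi = (translation y).`_pi.
  have hallA := nilpotent_pcore_Hall pi (abelian_nil translation_group_abelian).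
  rewrite -(card_Hall hallA) => leT.
  apply: (@equivariant_small_constant T _ [group of G] _
    (fun z => (translation z).`_pi) (fun h => (perm (mulgI h))^-1)) leT _ _ _
    => // [z|].
  - rewrite (mem_normal_Hall hallA (pcore_normal _ _)) ?p_elt_constt //.
    by rewrite groupX ?mem_translation_group.
  - by move=> h z Gh; rewrite translationJ // consttJ.
have p'm : #|T|^'.-nat m.
  by rewrite p'natE // gtnNdvd.
have cardA : #|A| = (m * #|T|)%N by rewrite card_translation_group.
rewrite -(consttC #|T| (translation x)) -(consttC #|T| (translation y)).
have T_gt0 := prime_gt0 prT.
congr (_ * _); apply: pi_const; rewrite cardA partnM //.
  by rewrite part_p'nat // mul1n part_pnat_id ?pnat_id.
by rewrite part_pnat_id // part_p'nat ?muln1 ?(ltnW ltm) // pnatNK pnat_id.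
Qed.

End CycleSet.

(** * From symmetries of an arbitrary type to a finite group *)

Section Transport.

Variables (gT : groupType) (fT : finGroupType) (theta : gT -> fT).
Hypothesis thetaM : {morph theta : g h / g * h >-> g * h}.
Hypothesis theta_inj : injective theta.

Lemma transport1 : theta 1 = 1.
Proof. by apply: (mulgI (theta 1)); rewrite -thetaM !mulg1. Qed.

Lemma transportV g : theta g^-1 = (theta g)^-1.
Proof. by apply: (mulgI (theta g)); rewrite -thetaM !mulgV transport1. Qed.

Lemma preim_subgroup (K : {group fT}) :
  is_subgroup [set g | theta g \in K]%classic.
Proof.
split=> [|g h Kg Kh|g Kg] /=; first by rewrite transport1 group1.
  by rewrite thetaM groupM.
by rewrite transportV groupV.
Qed.

(** The target is finite, so its subgroups are generated as monoids, and a
    generated subgroup can be lifted product by product. *)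
Lemma transport_gen (I : finType) (f : I -> gT) g :
  theta g \in <<[set theta (f i) | i : I]>> <-> subgroup_gen (range f) g.
Proof.
have [gen1 genM _] := subgroup_gen_subgroup (range f).
split=> [/gen_prodgP[n [c Sc]] | genf]; last first.
  apply: (genf [set g | theta g \in <<_>>]%classic); split.
    exact: (preim_subgroup <<_>>).
  by move=> _ [i _ <-] /=; rewrite mem_gen // imset_f.
suff [h genh <-] : exists2 h, subgroup_gen (range f) h & theta h = \prod_i c i.
  by move/theta_inj->.
elim: n c Sc => [|n IHn] c Sc.
  by exists 1; rewrite // big_ord0 transport1.
have [|h genh def_h] := IHn (fun i => c (widen_ord (leqnSn n) i)); first by [].
have /imsetP[i _ def_c] := Sc ord_max.
exists (h * f i); last by rewrite big_ord_recr thetaM def_h def_c.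
by apply: genM => // H [_ fH]; apply: fH; exists i.
Qed.

Lemma transport_cycle g h :
  theta h \in <[theta g]> <-> subgroup_gen [set g]%classic h.
Proof.
have -> : [set g]%classic = range (fun _ : unit => g).
  by apply/seteqP; split=> [_ -> | _ [_ _ <-]] //; exists tt.
rewrite -transport_gen.
suff -> : [set theta g | _ : unit] = [set theta g] by [].
by apply/setP=> y; rewrite inE; apply/imsetP/eqP=> [[] | ->] //; exists tt.
Qed.

Hypothesis theta_surj : forall y, exists g, theta g = y.

Lemma transport_minimal_noncyclic (H : set gT) (G : {group fT}) :
    (forall g, theta g \in G <-> H g) -> minimal_noncyclic H ->
  ~~ cyclic G /\ forall K : {group fT}, K \proper G -> cyclic K.
Proof.
move=> defH [_ _ ncycH cycP]; split.
  apply/negP=> /cyclicP[y defG]; case: ncycH.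
  have [g def_y] := theta_surj y; exists g; apply/seteqP.
  by split=> h; rewrite -defH defG -def_y => /transport_cycle.
move=> K /properP[sKG [y Gy nKy]].
have [] := cycP [set g | theta g \in K]%classic (preim_subgroup K).
  split=> [g Kg | sHK]; first by apply/defH/(subsetP sKG).
  have [g def_y] := theta_surj y; case/negP: nKy; rewrite -def_y.
  by apply: sHK; apply/defH; rewrite def_y.
move=> g defK; apply/cyclicP; exists (theta g); apply/setP=> z.
have [h <-] := theta_surj z.
have := transport_cycle g h; rewrite -defK /= => eqK.
by apply/idP/idP=> /eqK.
Qed.

End Transport.

Section FiniteCarrier.

Variables (X : Type) (T : finType) (e : X -> T) (d : T -> X).
Hypotheses (eK : cancel e d) (dK : cancel d e).

(** Symmetries of X compose from right to left and permutations of a finite type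
    from left to right; the inverse makes [relabel] a morphism. It also turns
    sigma_x into the operation y |-> x . y of the cycle set. *)
Lemma relabel_subproof (g : sym X) : injective (fun t => e ((g^-1) (d t))).
Proof.
move=> t u eq_tu; apply: (can_inj dK); apply: (bij_inj (sym_bij g^-1)).
exact: (can_inj eK).
Qed.

Definition relabel g : {perm T} := perm (@relabel_subproof g).

Lemma relabelM : {morph relabel : g h / g * h >-> g * h}.
Proof. by move=> g h; apply/permP=> t; rewrite permM !permE invMg eK. Qed.

Lemma relabel_inj : injective relabel.
Proof.
move=> g h eq_gh; apply: invg_inj; apply: symP => x.
have := congr1 (fun p : {perm T} => p (e x)) eq_gh.
by rewrite !permE eK => /(can_inj eK).
Qed.

Lemma relabel_surj p : exists g, relabel g = p.
Proof.
have bij_p : bijective (fun x => d (p (e x))).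
  by exists (fun x => d ((p^-1) (e x))) => x /=; rewrite dK ?permK ?permKV eK.
by exists (Defs.Sym bij_p)^-1; apply/permP=> t; rewrite permE invgK /= !dK.
Qed.

End FiniteCarrier.

(** * The cycle set of an involutive solution *)

Section Solution.

Variables (X : Type) (r : solution X).
Local Notation sg := (sigma r).

Lemma sol_rE x y : r (x, y) = (sg x y, (r (x, y)).2).
Proof. exact: surjective_pairing. Qed.

Lemma sigma_tau x y : sg (sg x y) (r (x, y)).2 = x.
Proof. by have := sol_involutive r (x, y); rewrite sol_rE => /(congr1 fst). Qed.

Lemma tau_sigmaV x y : (r (x, (sg x)^-1 y)).2 = (sg y)^-1 x.
Proof.
have := sigma_tau x ((sg x)^-1 y).
have -> : sg x ((sg x)^-1 y) = y by apply: sym_invKV.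
by move/(congr1 (sg y)^-1%g) => <-; rewrite (sym_invK (sg y)).
Qed.

Lemma sigma_braid x y : sg x * sg y = sg (sg x y) * sg (r (x, y)).2.
Proof.
by apply: symP => z; have /(congr1 (fst \o fst)) := sol_braid r (x, y, z).
Qed.

(** Involutivity expresses tau through sigma ([tau_sigmaV]); the braid relation
    then becomes symmetric in x and y. *)
Lemma sigma_cycle_law x y :
  sg x * sg ((sg x)^-1 y) = sg y * sg ((sg y)^-1 x).
Proof.
rewrite sigma_braid tau_sigmaV; congr (sg _ * _); exact: sym_invKV.
Qed.

(** If x . x = z, then r fixes the pair (x, z) by [tau_sigmaV], so that x is the
    preimage of z under tau_z. *)
Lemma sigma_diag_inj : injective (fun x => (sg x)^-1 x).
Proof.
move=> x y /= eq_xy; apply: (bij_inj (sol_tau_bij r ((sg x)^-1 x))) => /=.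
by rewrite tau_sigmaV {2}eq_xy tau_sigmaV.
Qed.

Lemma indecomposable_finite :
  indecomposable r -> finite_set (permutation_group r) ->
  exists (n : nat) (e : X -> 'I_n) (d : 'I_n -> X), cancel e d /\ cancel d e.
Proof.
move=> trG finG; have [x0 _] := sol_nonempty r.
have : finite_set [set: X]%classic.
  apply: sub_finite_set (finite_image (fun g : sym X => g x0) finG) => x _.
  by have [g Gg <-] := trG x0 x; exists g.
case=> n /card_set_bijP[f [fn finj fsurj]].
have fP x : f x < n by apply: fn.
have dP (i : 'I_n) : exists x, f x = i.
  by have [x _] := fsurj i (ltn_ord i); exists x.
pose d i := projT1 (cid (dP i)).
have dE i : f (d i) = i by rewrite /d; case: cid.
exists n, (fun x => Ordinal (fP x)), d; split=> [x | i].
  by apply: finj; rewrite ?dE ?classical_sets.in_setT.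
by apply: val_inj; rewrite /= dE.
Qed.

End Solution.

(** * Uniconnectedness *)

Theorem theorem4p2 (X : Type) (r : solution X) :
  indecomposable r ->
  minimal_noncyclic (permutation_group r) ->
  uniconnected r.
Proof.
move=> trX minG; split=> // g x Gg gx; have [_ finG _ _] := minG.
have [n [e [d [eK dK]]]] := indecomposable_finite trX finG.
pose theta := relabel eK dK.
have thetaM : {morph theta : g h / g * h >-> g * h} := relabelM eK dK.
have theta_inj : injective theta := @relabel_inj _ _ _ _ eK dK.
have theta_surj : forall p, exists g, theta g = p := relabel_surj eK dK.
pose s i := theta (sigma r (d i)).
have sE i j : s i j = e ((sigma r (d i))^-1 (d j)) by rewrite permE.
have cycle_s i j : s i * s (s i j) = s j * s (s j i).
  by rewrite !sE /s !eK -!thetaM sigma_cycle_law.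
have diag_s : injective (fun i => s i i).
  move=> i j /= eq_ij; apply: (can_inj dK); apply: (@sigma_diag_inj _ r).
  by apply: (can_inj eK); rewrite -!sE.
pose G := [group of cycle_group s].
have defG h : theta h \in G <-> permutation_group r h.
  rewrite transport_gen // /permutation_group.
  suff -> : range (sigma r \o d) = range (sigma r) by [].
  apply/seteqP; split=> _ [y _ <-]; first by exists (d y).
  by exists (e y); rewrite //= eK.
have [ncG cycP] :=
  transport_minimal_noncyclic thetaM theta_inj theta_surj defG minG.
have trG : [transitive G, on [set: 'I_n] | 'P].
  apply/imsetP; exists (e x); rewrite ?inE //; apply/esym/setP=> i; rewrite inE.
  have [h Gh hx] := trX (d i) x; apply/imsetP; exists (theta h).
    exact/defG.
  by rewrite /= /aperm permE eK -hx (sym_invK h) dK.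
apply: contrapT => g1.
have [|prn dvn ltn] := nonregular_prime_degree (x := e x) trG ncG cycP.
  apply/trivgPn; exists (theta g).
    apply/setIP; split; [exact/defG | apply/astab1P].
    by rewrite /= /aperm permE eK -{1}gx (sym_invK g).
  by apply/eqP=> tg1; apply: g1; apply: theta_inj; rewrite tg1 transport1.
have const_s := prime_degree_constant cycle_s diag_s trG prn dvn ltn.
case/negP: ncG; apply/cyclicP; exists (s (e x)).
congr <<_>>; apply/setP=> p; rewrite inE.
by apply/imsetP/eqP=> [[i _ ->] | ->]; [apply: const_s | exists (e x)].
Qed.
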